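(* There exists $K>0$ such that $\{x\in(\frac34,\infty)\mid \liminf_{n\to\infty} C_{\mathbb R}^n(x)\leq K\}$ is a Lebesgue-co-null subset of $(\frac34,\infty)$.
   Context: For $x\in\mathbb R$ let $[x]$ be the unique integer with $x-[x]\in(-\frac12,\frac12]$. The map $C_{\mathbb R}$ is defined by $C_{\mathbb R}(x)=\frac{x}{2}$ if $[x]$ is even and $C_{\mathbb R}(x)=\frac{3x}{2}$ if $[x]$ is odd; it maps $(0,\infty)$ to itself, and $C_{\mathbb R}^n$ is its $n$-th iterate. For Lebesgue-measurable $A\subseteq B\subseteq\mathbb R$, $A$ is Lebesgue-co-null in $B$ if $\lambda(B\setminus A)=0$, where $\lambda$ is Lebesgue measure. *)

(* Defs.v *)
From HB Require Import structures.
From mathcomp Require Import all_boot all_order all_algebra.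
From mathcomp Require Import all_classical all_reals all_analysis.
From mathcomp Require Import lra.
Import Order.TTheory GRing.Theory Num.Theory.
Import numFieldNormedType.Exports.

Set Implicit Arguments.
Unset Strict Implicit.
Unset Printing Implicit Defensive.

Local Open Scope classical_set_scope.
Local Open Scope ring_scope.

(* Nearest integer with ties rounded down, since x - [x] lies in ]-1/2, 1/2]. *)
Definition nearest_int (R : realType) (x : R) : int := Num.ceil (x - 1 / 2).

Lemma nearest_intP (R : realType) (x : R) (m : int) :
  (- (1 / 2) < x - m%:~R <= 1 / 2) <-> m = nearest_int x.
Proof.
rewrite /nearest_int; split=> [/andP[h1 h2]|->].
  apply/esym/eqP; rewrite ceil_eq rmorphB /=; apply/andP; split; lra.
have := ceil_itv (x - 1 / 2); rewrite rmorphB /= => /andP[h1 h2].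
by apply/andP; split; lra.
Qed.

Definition collatz_real (R : realType) (x : R) : R :=
  if (2 %| nearest_int x)%Z then x / 2 else 3 * x / 2.

(* The Lebesgue sigma-algebra, i.e. the completion of the Borel one (see
   [completed_caratheodory_measurable]). *)
Definition lebesgue_measurable (R : realType) (A : set R) : Prop :=
  ((@wlength R idfun)^*)%mu.-cara.-measurable A.

Definition lebesgue_conull (R : realType) (A B : set R) : Prop :=
  [/\ lebesgue_measurable A, lebesgue_measurable B, A `<=` B &
      @completed_lebesgue_measure R (B `\` A) = 0%E].

(* Main.v *)
Require Import Defs.
From HB Require Import structures.
From mathcomp Require Import all_boot all_order all_algebra.
From mathcomp Require Import all_classical all_reals all_analysis.
From mathcomp Require Import measurable_realfun ring lra zify.
Import Order.TTheory GRing.Theory Num.Theory.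
Import numFieldNormedType.Exports.

Set Implicit Arguments.
Unset Strict Implicit.
Unset Printing Implicit Defensive.

Local Open Scope classical_set_scope.
Local Open Scope ring_scope.

(**
Write C for the map. If o of the first k iterates of x round to an odd
integer, then C^k x = 3^o / 2^k * x, and o is distributed over an interval of
length at least 2^k like a number of heads in k fair coin tosses. Since
log 2 / log 3 > 3/5 > 1/2, a point x of [3^l, 3^(l+1)) has C^l x much smaller
than x, unless it is exceptional (o >= 3 l / 5), and the exceptional points
above 3^l0 have small measure for dx/x.

Modulo multiplication by 3, the map C is x |-> x / 2, an irrational rotation
in the coordinate log x. An orbit that stays above 3^l0 has to meet the
projection Bad of the exceptional set modulo 3 with a frequency bounded below,
for otherwise it would decrease to 0. The points x whose rotation orbit
x, x / 2, x / 4, ... meets Bad with such a frequency form a set that is stable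
under multiplication by 2 and division by 3, hence null or co-null in
(0, oo) by ergodicity; averaging over [1, 3), it is not co-null, because Bad is
small.
*)

(** * Distribution of the parities *)

Section parity_statistics.
Variable R : realType.
Implicit Types (x y t : R) (k n q : nat).

Definition odd_step x : bool := ~~ (2 %| nearest_int x)%Z.

Fixpoint odd_count k x : nat :=
  if k is k'.+1 then odd_step x + odd_count k' (collatz_real x) else 0.

Lemma collatz_realE x : collatz_real x = 3 ^+ odd_step x / 2 * x.
Proof.
rewrite /collatz_real /odd_step; case: ifP => _ /=; first by rewrite expr0; lra.
by rewrite expr1; lra.
Qed.

Lemma iter_collatzE k x :
  iter k (@collatz_real R) x = 3 ^+ odd_count k x / 2 ^+ k * x.
Proof.
elim: k x => [|k IH] x; first by rewrite /= !expr0 divr1 mul1r.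
rewrite iterSr IH /= exprD exprS collatz_realE.
by field; rewrite expf_neq0.
Qed.

Lemma nearest_int_addn x n : nearest_int (x + n%:R) = nearest_int x + n%:Z.
Proof.
apply/esym/nearest_intP; have /nearest_intP := erefl (nearest_int x).
by rewrite rmorphD /= => /andP[? ?]; apply/andP; split; lra.
Qed.

Lemma odd_step_addn x n : odd_step (x + n%:R) = odd_step x (+) odd n.
Proof.
rewrite /odd_step nearest_int_addn.
have mod2 (z : int) : (2 %| z)%Z = ~~ odd `|z|%N by rewrite dvdzE dvdn2.
rewrite !mod2 !negbK.
lia.
Qed.

Lemma sum_ord_double (V : nmodType) (F : nat -> V) n :
  \sum_(i < n.*2) F i = \sum_(i < n) (F i.*2 + F i.*2.+1).
Proof.
elim: n => [|n IH]; first by rewrite !big_ord0.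
by rewrite doubleS !big_ord_recr /= IH addrA.
Qed.

(* Along x, x + q, x + 2q, ... the parities alternate, and one iteration turns
   every other term into a progression of step q or 3q: this is why the step is
   an arbitrary odd number. *)
Lemma sum_odd_count q k x : odd q ->
  \sum_(n < 2 ^ k) (3 / 2 : R) ^+ odd_count k (x + q%:R * n%:R) = (5 / 2) ^+ k.
Proof.
elim: k q x => [|k IH] q x oq.
  by rewrite expn0 big_ord1 /= !expr0.
have even_case y : ~~ odd_step y ->
    \sum_(j < 2 ^ k) (3 / 2 : R) ^+ odd_count k.+1 (y + q%:R * j.*2%:R) =
    (5 / 2) ^+ k.
  move=> oy; rewrite -(IH q (y / 2) oq); apply: eq_bigr => j _ /=.
  rewrite collatz_realE -natrM odd_step_addn oddM odd_double andbF addbF.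
  rewrite (negbTE oy) add0n expr0; congr (_ ^+ odd_count k _).
  by rewrite natrM -mul2n natrM; lra.
have odd_case y : odd_step y ->
    \sum_(j < 2 ^ k) (3 / 2 : R) ^+ odd_count k.+1 (y + q%:R * j.*2%:R) =
    3 / 2 * (5 / 2) ^+ k.
  move=> oy; have o3q : odd (3 * q) by rewrite oddM.
  rewrite -(IH _ (3 / 2 * y) o3q) mulr_sumr; apply: eq_bigr => j _ /=.
  rewrite collatz_realE -natrM odd_step_addn oddM odd_double andbF addbF.
  rewrite oy exprD expr1; congr (_ * _ ^+ odd_count k _).
  by rewrite !natrM -mul2n natrM; lra.
rewrite expnS mul2n.
rewrite (sum_ord_double
  (fun n => (3 / 2 : R) ^+ odd_count k.+1 (x + q%:R * n%:R))) big_split /=.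
have shift j : x + q%:R * j.*2.+1%:R = (x + q%:R) + q%:R * j.*2%:R.
  by rewrite -addn1 natrD; ring.
under [X in _ + X]eq_bigr do rewrite shift.
have := odd_step_addn x q; rewrite oq addbT.
case: (boolP (odd_step x)) => ox oxq.
  have := even_case (x + q%:R); rewrite oxq => /(_ isT) /= ->.
  by have := odd_case _ ox; rewrite /= => ->; rewrite exprS; lra.
have := odd_case (x + q%:R); rewrite oxq => /(_ isT) /= ->.
by have := even_case _ ox; rewrite /= => ->; rewrite exprS; lra.
Qed.

(* The threshold 3/5 lies strictly between the typical frequency 1/2 and the
   break-even frequency log 2 / log 3. *)
Definition often_odd k : set R := [set x | (3 * k <= 5 * odd_count k x)%N].

(* 51/40 is slightly below (3/2)^(3/5), and (5/2) / (51/40) = 100/51 < 2. *)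
Lemma often_odd_weight k x : often_odd k x ->
  (51 / 40 : R) ^+ k <= (3 / 2) ^+ odd_count k x.
Proof.
move=> kx; rewrite -(@ler_pXn2r _ 5) ?nnegrE ?exprn_ge0 //; try lra.
rewrite -!exprM (mulnC _ 5) (mulnC _ 5).
apply: (@le_trans _ _ ((3 / 2) ^+ (3 * k)));
  last by apply: ler_weXn2l => //; lra.
rewrite !exprM; apply: lerXn2r; rewrite ?nnegrE; lra.
Qed.

(** Chernoff bound: weighting every odd step by 3/2 gives total weight [(5 / 2) ^+ k] over [2 ^ k]
    consecutive translates, and each term counted here weighs at least [(51 / 40) ^+ k]. *)
Lemma sum_often_odd k x :
  \sum_(n < 2 ^ k) \1_(often_odd k) (x + n%:R) <= (100 / 51 : R) ^+ k.
Proof.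
have := @sum_odd_count 1 k x isT.
under eq_bigr do rewrite mul1r.
move=> H; rewrite -(ler_pM2r (exprn_gt0 k (ltac:(lra) : 0 < 51 / 40 :> R))).
rewrite -exprMn (_ : 100 / 51 * (51 / 40) = 5 / 2); last by lra.
rewrite -H mulr_suml; apply: ler_sum => n _; rewrite indicE.
case: (boolP (_ \in _)) => [/set_mem /often_odd_weight|_].
  by rewrite mul1r.
by rewrite mul0r exprn_ge0 //; lra.
Qed.

Lemma sum_often_odd_muln k N x :
  \sum_(n < N * 2 ^ k) \1_(often_odd k) (x + n%:R)
  <= N%:R * (100 / 51 : R) ^+ k.
Proof.
elim: N => [|N IH]; first by rewrite mul0n big_ord0 mul0r.
rewrite mulSn addnC big_split_ord /= -natr1 mulrDl mul1r lerD //.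
apply: le_trans (sum_often_odd k (x + (N * 2 ^ k)%:R)).
by under eq_bigr do rewrite natrD addrA.
Qed.

End parity_statistics.

(** * Bad times along an orbit *)

Section bad_times.
Variable R : realType.
Implicit Types (x y : R) (k l m n i d : nat).

Definition exceptional l0 : set R := [set y | exists l,
  [/\ (l0 <= l)%N, 3 ^+ l <= y, y < 3 ^+ l.+1 & often_odd l y]].

(* The i-th iterate of x is 3^o / 2^i * x for some o; quantifying over all
   powers of 3 makes badness at time i depend on the halvings of x only. *)
Definition bad l0 i : set R :=
  [set x | exists m, exceptional l0 (3 ^+ m / 2 ^+ i * x)].

Definition bad_count l0 n x : nat := \sum_(i < n) (x \in bad l0 i).

(** Frequency at least 1/13 up to a bounded defect [d]; 13 is an exponent with
    [9 <= (32 / 27) ^+ 13]. The defect lets the union over [d] be stable under doubling. *)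
Definition bad_often l0 d : set R :=
  [set x | forall n, (n <= 13 * bad_count l0 n x + d)%N].

Lemma expr_level (b x : R) : 1 < b -> 1 <= x ->
  exists l, b ^+ l <= x /\ x < b ^+ l.+1.
Proof.
move=> b1 x1; have bernoulli n : 1 + (b - 1) * n%:R <= b ^+ n.
    elim: n => [|n IH]; first by rewrite mulr0 expr0 addr0.
    by rewrite -natr1 exprS; have := exprn_ege1 n (ltW b1); nra.
have x_lt : exists n, x < b ^+ n.
  exists (Num.bound `|(x - 1) / (b - 1)|); apply: lt_le_trans (bernoulli _).
  rewrite -ltrBlDl mulrC -ltr_pdivrMr ?subr_gt0 //.
  by apply: le_lt_trans (archi_boundP (normr_ge0 _)); rewrite ler_norm.
have [[|l] xl min_l] := ex_minnP x_lt; first by rewrite expr0 in xl; lra.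
exists l; split => //; rewrite leNgt; apply/negP => /min_l.
by rewrite ltnn.
Qed.

Lemma bad_iter l0 k i x :
  bad l0 i (iter k (@collatz_real R) x) -> bad l0 (k + i) x.
Proof.
move=> [m]; rewrite iter_collatzE => H; exists (m + odd_count k x)%N.
by move: H; rewrite !exprD; congr exceptional; field; rewrite !expf_neq0.
Qed.

(** By [bad_iter], a bad time of the iterate is, after a shift by [k], a bad time of [x]. Only an
    inequality results: the power of 3 gained along the orbit is added to [m], and a natural [m]
    need not allow its removal. *)
Lemma bad_count_iter l0 k j x :
  (bad_count l0 k x + bad_count l0 j (iter k (@collatz_real R) x)
   <= bad_count l0 (k + j) x)%N.
Proof.
rewrite /bad_count big_split_ord /= leq_add2l; apply: leq_sum => i _.
case: (boolP (_ \in _)) => // /set_mem /bad_iter /mem_set ->.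
by [].
Qed.

Lemma iter_collatz_ge0 k x : 0 <= x -> 0 <= iter k (@collatz_real R) x.
Proof.
by move=> x0; rewrite iter_collatzE !mulr_ge0 ?invr_ge0 ?exprn_ge0.
Qed.

(** Fifth powers avoid the fractional exponent 3/5: [5 * o <= 3 * l] gives
    [3 ^+ (5 * o) <= 27 ^+ l], against the denominator [32 ^+ l]. *)
Lemma not_often_odd_le l x : 0 <= x -> ~ often_odd l x ->
  iter l (@collatz_real R) x ^+ 5 <= (27 / 32) ^+ l * x ^+ 5.
Proof.
move=> x0 /negP; rewrite -ltnNge => /ltnW ol.
rewrite iter_collatzE exprMn ler_wpM2r ?exprn_ge0 // !expr_div_n.
have -> : 27 = 3 ^+ 3 :> R by lra.
have -> : 32 = 2 ^+ 5 :> R by lra.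
rewrite -!exprM (mulnC l) ler_pM2r ?invr_gt0 ?exprn_gt0 //.
by rewrite ler_weXn2l ?(mulnC _ 5) //; lra.
Qed.

(* Induction on n, jumping l steps ahead if x in [3^l, 3^(l+1)) is not
   exceptional, which multiplies x^5 by at most (27/32)^l, and one step ahead
   otherwise, which costs a factor (3/2)^5 = 9 * (27/32). *)
Lemma orbit_bound l0 n x : (0 < l0)%N ->
  (forall k, 3 ^+ l0 <= iter k (@collatz_real R) x) ->
  (32 / 27) ^+ n <= 9 ^+ bad_count l0 n x * x ^+ 5.
Proof.
have r0 : 0 <= 32 / 27 :> R by lra.
have r1 : 1 <= 32 / 27 :> R by lra.
have r3 : 32 / 27 <= 3 ^+ 5 :> R by lra.
have r9 : 9 = 32 / 27 * (3 / 2) ^+ 5 :> R by lra.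
have nine1 : 1 <= 9 :> R by lra.
move=> l0_gt0; elim/ltn_ind: n x => n IH x orb.
have orbk k j :
    3 ^+ l0 <= iter j (@collatz_real R) (iter k (@collatz_real R) x).
  by rewrite -iterD.
have x3 : 3 ^+ l0 <= x by exact: orb 0%N.
have x1 : 1 <= x by apply: le_trans x3; rewrite exprn_ege1 //; lra.
have x0 : 0 <= x by lra.
have c1 : 1 <= 9 ^+ bad_count l0 n x :> R by rewrite exprn_ege1 //; lra.
have [l [lx xl]] := expr_level (ltac:(lra) : 1 < 3 :> R) x1.
have l0l : (l0 <= l)%N.
  by rewrite -ltnS -(@ltr_eXn2l R 3) ?(le_lt_trans x3) //; lra.
have [lodd|lodd] := pselect (often_odd l x); last first.
  have [nl|ln] := leqP n l.
    apply: (@le_trans _ _ (x ^+ 5)); last by rewrite ler_peMl ?exprn_ge0.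
    apply: (@le_trans _ _ ((3 ^+ l) ^+ 5));
      last by rewrite lerXn2r ?nnegrE ?exprn_ge0.
    rewrite -exprM mulnC exprM.
    apply: (@le_trans _ _ ((32 / 27) ^+ l)); first by rewrite ler_weXn2l.
    by rewrite lerXn2r ?nnegrE ?exprn_ge0.
  have nE : n = (l + (n - l))%N by rewrite subnKC // ltnW.
  have nl_lt : (n - l < n)%N.
    by rewrite ltn_subrL (leq_trans l0_gt0 l0l) (leq_ltn_trans (leq0n l)).
  have {IH} := IH (n - l)%N nl_lt _ (orbk l) => IH.
  rewrite [in leLHS]nE exprD.
  have yx := not_often_odd_le x0 lodd.
  have cc := bad_count_iter l0 l (n - l) x; rewrite -nE in cc.
  apply: (@le_trans _ _ ((32 / 27) ^+ l *
     (9 ^+ bad_count l0 n x * ((27 / 32) ^+ l * x ^+ 5)))).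
    rewrite ler_wpM2l ?exprn_ge0 //.
    apply: (le_trans IH).
    apply: ler_pM; rewrite ?exprn_ge0 ?iter_collatz_ge0 //.
    by rewrite ler_weXn2l // (leq_trans (leq_addl _ _) cc).
  rewrite [leLHS](_ : _ = ((32 / 27) ^+ l * (27 / 32) ^+ l) *
      (9 ^+ bad_count l0 n x * x ^+ 5)); last by ring.
  rewrite -exprMn.
  by rewrite (_ : 32 / 27 * (27 / 32) = 1) ?expr1n ?mul1r ?mulrA //; field.
(* Now [x] is exceptional, so time 0 is bad with [m = 0], and this bad time supplies the factor 9
   that pays for a single step. *)
case: n IH c1 => [|n] IH c1; first by rewrite expr0 mulr_ege1 // exprn_ege1.
have {IH} := IH n (ltnSn n) _ (orbk 1%N) => IH.
have := bad_count_iter l0 1 n x.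
have -> : bad_count l0 1 x = 1%N.
  rewrite /bad_count big_ord1 mem_set //; exists 0%N.
  by rewrite !expr0 divr1 mul1r; exists l.
rewrite add1n => cc.
rewrite exprS.
have y0 := iter_collatz_ge0 1 x0.
have yx : iter 1 (@collatz_real R) x <= 3 / 2 * x.
  by rewrite /= /collatz_real; clear -x0; case: ifP => _; lra.
apply: (@le_trans _ _
  (9 * (9 ^+ bad_count l0 n (iter 1 (@collatz_real R) x) * x ^+ 5))).
  rewrite [X in _ <= X * _]r9.
  rewrite -[leRHS]mulrA ler_wpM2l //.
  apply: (le_trans IH); rewrite [leRHS]mulrCA -[X in _ <= _ * X]exprMn.
  by rewrite ler_wpM2l ?exprn_ge0 // lerXn2r // nnegrE // mulr_ge0.
by rewrite mulrA -exprS ler_wpM2r ?exprn_ge0 // ler_weXn2l.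
Qed.

(** Taking logarithms in [orbit_bound]: each factor 9 is at most [(32 / 27) ^+ 13], and [x ^+ 5] is
    absorbed into the defect. *)
Lemma orbit_bad_often l0 x : (0 < l0)%N ->
  (forall k, 3 ^+ l0 <= iter k (@collatz_real R) x) ->
  exists d, bad_often l0 d x.
Proof.
have r0 : 0 <= 32 / 27 :> R by lra.
have r1 : 1 <= 32 / 27 :> R by lra.
have r13 : 9 <= (32 / 27) ^+ 13 :> R by lra.
move=> l0_gt0 orb; have x3 : 3 ^+ l0 <= x := orb 0%N.
have x1 : 1 <= x ^+ 5.
  by rewrite exprn_ege1 //; apply: le_trans x3; rewrite exprn_ege1 //; lra.
have [d [_ xd]] := expr_level (ltac:(lra) : 1 < 32 / 27 :> R) x1.
exists d.+1 => n; have := orbit_bound n l0_gt0 orb => H.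
rewrite leqNgt; apply/negP => big.
suff : 9 ^+ bad_count l0 n x * x ^+ 5 < (32 / 27) ^+ n by rewrite ltNge H.
apply: (@lt_le_trans _ _ ((32 / 27) ^+ (13 * bad_count l0 n x + d.+1))).
  rewrite exprD; apply: (@lt_le_trans _ _
    (9 ^+ bad_count l0 n x * (32 / 27) ^+ d.+1)).
    by rewrite ltr_pM2l ?exprn_gt0.
  by rewrite ler_wpM2r ?exprn_ge0 // exprM lerXn2r ?nnegrE ?exprn_ge0.
by rewrite ler_weXn2l //; lia.
Qed.

Lemma bad_half l0 i x : bad l0 i (x / 2) <-> bad l0 i.+1 x.
Proof.
rewrite /bad /=.
have E m : 3 ^+ m / 2 ^+ i * (x / 2) = 3 ^+ m / 2 ^+ i.+1 * x.
  by rewrite exprS; field; rewrite expf_neq0.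
by split=> -[m H]; exists m; move: H; rewrite E.
Qed.

(** The halvings of [2 * x] are those of [x] preceded by one more point, which costs at most one
    unit of defect. *)
Lemma bad_often_double l0 d x : bad_often l0 d x -> bad_often l0 d.+1 (2 * x).
Proof.
move=> H [//|n].
have -> : bad_count l0 n.+1 (2 * x) =
    (((2 * x)%R \in bad l0 0) + bad_count l0 n x)%N.
  rewrite /bad_count big_ord_recl; congr addn; apply: eq_bigr => i _.
  have E : 2 * x / 2 = x by rewrite mulrAC divff // mul1r.
  congr nat_of_bool; apply/idP/idP => /set_mem; last first.
    by rewrite -{1}E => /bad_half/mem_set.
  by move=> /bad_half/mem_set; rewrite E.
by have := H n; lia.
Qed.

Lemma bad_third l0 i x : bad l0 i x -> bad l0 i (x / 3).
Proof.
move=> [m H]; exists m.+1; move: H; congr exceptional.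
by rewrite exprS; field; rewrite expf_neq0.
Qed.

Lemma bad_often_third l0 d x : bad_often l0 d x -> bad_often l0 d (x / 3).
Proof.
move=> H n; apply: leq_trans (H n) _; rewrite leq_add2r leq_mul2l /=.
apply: leq_sum => i _; case: (boolP (_ \in _)) => // /set_mem /bad_third.
by move/mem_set ->.
Qed.

(** One step of the map is undone by a doubling, followed by a division by 3 after an odd step; both
    operations preserve the property up to the defect. *)
Lemma bad_often_iter l0 k x :
  (exists d, bad_often l0 d (iter k (@collatz_real R) x)) ->
  exists d, bad_often l0 d x.
Proof.
elim: k x => [//|k IH] x; rewrite iterSr => /IH [d H].
have -> : x = (2 * collatz_real x) / (3 ^+ odd_step x).
  by rewrite collatz_realE; field; rewrite expf_neq0.
case: odd_step; rewrite ?expr1 ?expr0 ?divr1.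
  by exists d.+1; apply/bad_often_third/bad_often_double.
by exists d.+1; exact/bad_often_double.
Qed.

Lemma bad_often_gt0 l0 d x : bad_often l0 d x -> 0 < x.
Proof.
move=> H; rewrite ltNge; apply/negP => x0; have := H d.+1.
have -> : bad_count l0 d.+1 x = 0%N.
  rewrite /bad_count big1 // => i _; apply/eqP; rewrite eqb0; apply/negP.
  move=> /set_mem[m [l [_ + _ _]]]; apply/negP; rewrite -ltNge.
  apply: (@le_lt_trans _ _ 0); last by rewrite exprn_gt0.
  by rewrite mulr_ge0_le0 // divr_ge0 ?exprn_ge0.
by rewrite muln0 add0n ltnn.
Qed.

End bad_times.

(** * Measure of the bad times *)

Section measurability.
Variable R : realType.
Implicit Types (x y : R) (k l m n i d : nat).

Lemma measurable_odd_step : measurable_fun [set: R] (@odd_step R).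
Proof.
apply: (measurable_fun_bool true); rewrite setTI.
pose cell (z : int) := `](z%:~R - 1 / 2 : R), z%:~R + 1 / 2]%classic.
have cellP z x : cell z x <-> z = nearest_int x.
  rewrite -nearest_intP /cell /= in_itv /=.
  by split=> /andP[? ?]; apply/andP; split; lra.
rewrite (_ : _ @^-1` _ = \bigcup_(z in [set z : int | ~~ (2 %| z)%Z]) cell z).
  rewrite bigcup_mkcond; apply: countable_bigcupT_measurable => // z.
  by case: ifP => _ //; exact: measurable_itv.
apply/seteqP; split=> x /=; first by exists (nearest_int x) => //; exact/cellP.
by move=> [z oz /cellP zx]; rewrite /odd_step -zx.
Qed.

Lemma measurable_collatz : measurable_fun [set: R] (@collatz_real R).
Proof.
apply: (@measurable_fun_ifT _ _ _ _ _ _ (fun x => (2 %| nearest_int x)%Z)).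
- have := measurable_neg measurable_odd_step.
  by apply: eq_measurable_fun => x _; rewrite /= /odd_step negbK.
- exact: measurable_funM.
- by apply: measurable_funM => //; exact: measurable_funM.
Qed.

Lemma measurable_odd_count k : measurable_fun [set: R] (@odd_count R k).
Proof.
elim: k => [|k IH] /=; first exact: measurable_cst.
apply: (eq_measurable_fun (fun x => if odd_step x
  then (1 + odd_count k (collatz_real x))%N
  else odd_count k (collatz_real x))).
  by move=> x _; case: odd_step.
have IHc : measurable_fun [set: R] (fun x => odd_count k (collatz_real x)).
  exact: measurableT_comp measurable_collatz.
apply: measurable_fun_ifT => //; first exact: measurable_odd_step.
by apply: measurable_fun_addn.
Qed.

Lemma measurable_often_odd k : measurable (@often_odd R k).
Proof.
rewrite (_ : often_odd k =
  [set: R] `&` @odd_count R k @^-1` [set o | 3 * k <= 5 * o]%N).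
  exact: measurable_odd_count.
by rewrite setTI.
Qed.

Lemma measurable_affine (a b : R) :
  measurable_fun [set: R] (fun x => a * x + b).
Proof. by apply: measurable_funD => //; exact: measurable_funM. Qed.

Lemma measurable_preimage_affine (a b : R) (A : set R) :
  measurable A -> measurable [set x | A (a * x + b)].
Proof.
by move=> mA; rewrite -[X in measurable X]setTI; exact: measurable_affine.
Qed.

(** By uniqueness of Lebesgue measure: [a] times its pushforward under the affine map gives
    half-open intervals their length. *)
Lemma lebesgue_measure_affine (a b : R) (A : set R) : 0 < a -> measurable A ->
  lebesgue_measure [set x | A (a * x + b)] = ((a^-1)%:E * lebesgue_measure A)%E.
Proof.
move=> a0 mA; pose an : {nonneg R} := NngNum (ltW a0).
pose f : measurableTypeR R -> measurableTypeR R := fun x => a * x + b.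
have mf : measurable_fun setT f by exact: measurable_affine.
pose mu := mscale an (pushforward (@lebesgue_measure R) f).
have -> : lebesgue_measure A = mu mf A.
  apply: lebesgue_measure_unique mA => _ [[u v] /= _ <-].
  rewrite /mu /mscale /= /pushforward.
  rewrite [X in (_ * lebesgue_measure X)%E](_ : _ =
    `](u - b) / a, (v - b) / a]%classic); last first.
    apply/seteqP; split=> x; rewrite /f /= !in_itv /=;
      by rewrite ltr_pdivrMr // ler_pdivlMr // ltrBlDr lerBrDr (mulrC x).
  rewrite !lebesgue_measure_itv /= !lte_fin ltr_pM2r ?invr_gt0 // ltrD2r.
  case: ifP => _; last by rewrite mule0.
  rewrite -!EFinD -EFinM -mulrBl opprB addrA subrK mulrCA.
  by rewrite divff ?mulr1 ?gt_eqF.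
by rewrite /mu /mscale /= /pushforward muleA -EFinM mulVf ?mul1e // gt_eqF.
Qed.

End measurability.

(** * Double counting for a finite family of sets *)

Section overlap.
Context d (T : measurableType d) (R : realType).
Variables (mu : {measure set T -> \bar R}) (D : set T) (E : nat -> set T).
Hypotheses (mD : measurable D) (mE : forall i, measurable (E i)).
Implicit Types (n : nat) (c : R).

Let overlap n x : \bar R := (\sum_(i < n) \1_(E i) x)%:E.

Let measurable_overlap n : measurable_fun D (overlap n).
Proof.
apply/measurable_EFinP; rewrite /overlap.
by apply: measurable_sum => i; exact: measurable_indic.
Qed.

Let integral_overlap n :
  (\sum_(i < n) mu (E i `&` D) = \int[mu]_(x in D) overlap n x)%E.
Proof.
rewrite /overlap; under eq_integral do rewrite -sumEFin.
rewrite ge0_integral_sum //.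
- by apply: eq_bigr => i _; rewrite integral_indic.
- by move=> i; apply/measurable_EFinP; exact: measurable_indic.
Qed.

Lemma sum_measure_le n c : (forall x, D x -> \sum_(i < n) \1_(E i) x <= c) ->
  (\sum_(i < n) mu (E i `&` D) <= c%:E * mu D)%E.
Proof.
move=> Ec; rewrite integral_overlap -integral_cst //.
apply: ge0_le_integral => //.
by move=> x _; rewrite lee_fin sumr_ge0 // => i _; rewrite indicE.
Qed.

Lemma sum_measure_ge n c : 0 <= c ->
  (forall x, D x -> c <= \sum_(i < n) \1_(E i) x) ->
  (c%:E * mu D <= \sum_(i < n) mu (E i `&` D))%E.
Proof.
move=> c0 cE; rewrite integral_overlap -integral_cst //.
exact: ge0_le_integral.
Qed.

End overlap.

(** * Geometric decay of the measure of the bad sets *)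

Section bad_measure.
Variable R : realType.
Implicit Types (t u x : R) (k l m n i : nat).
Local Notation lambda := (@lebesgue_measure R).
Local Notation domain := (`[1%R, 3%R[%classic : set R).

Lemma measure_cells_le (A : set R) (u h : R) N : 0 < h -> measurable A ->
  (lambda (A `&` `[u, (u + N%:R * h)%R[) <=
   \sum_(n < N) lambda ([set x | A (x + n%:R * h)%R] `&` `[u, (u + h)%R[))%E.
Proof.
move=> h0 mA; elim: N => [|N IH].
  by rewrite big_ord0 mul0r addr0 set_itvco0 setI0 measure0.
rewrite big_ord_recr /=; apply: le_trans (leeD IH (lexx _)).
have -> : lambda ([set x | A (x + N%:R * h)] `&` `[u, u + h[) =
    lambda (A `&` `[u + N%:R * h, u + N.+1%:R * h[).
  have := @lebesgue_measure_affine R 1 (N%:R * h)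
    (A `&` `[u + N%:R * h, u + N.+1%:R * h[) ltr01
    (measurableI _ _ mA (measurable_itv _)).
  rewrite invr1 mul1e => <-; congr lebesgue_measure.
  apply/seteqP; split=> x /=;
    rewrite mul1r !in_itv /= -natr1 mulrDl mul1r addrA.
    by rewrite lerD2r addrAC ltrD2r.
  by rewrite lerD2r addrAC ltrD2r.
apply: le_trans (measureU2 _ _ _); try by apply: measurableI.
apply: le_measure; rewrite ?inE.
- by apply: measurableI.
- by apply: measurableU; apply: measurableI.
move=> x [Ax] /=; rewrite !in_itv /= => /andP[ux xu].
by have [xN|xN] := ltP x (u + N%:R * h); [left|right]; split => //;
  rewrite /= ?in_itv /= ?ux ?xN.
Qed.

Definition often_odd_dilate k t : set R := [set x | often_odd k (t * x)].

Lemma measurable_often_odd_dilate k t : measurable (often_odd_dilate k t).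
Proof.
rewrite /often_odd_dilate.
under eq_set do rewrite -[t * _]addr0.
exact: measurable_preimage_affine (measurable_often_odd _).
Qed.

(** As [x] runs over the domain, [t * x] sweeps a length [2 * t], covered by [N] blocks of [2 ^ k]
    unit cells. Each block contributes at most [(100 / 51) ^+ k], and
    [N%:R * 2 ^+ k <= 2 * t + 2 ^+ k <= 5 * t]. *)
Lemma often_odd_measure k t : 0 < t -> 3 ^+ k <= 3 * t ->
  (lambda (often_odd_dilate k t `&` domain) <= (5 * (50 / 51) ^+ k)%:E)%E.
Proof.
move=> t0 kt; set A := often_odd_dilate k t.
have mA : measurable A by exact: measurable_often_odd_dilate.
have p0 : 0 < 2 ^+ k :> R by rewrite exprn_gt0.
have p23 : 2 ^+ k <= 3 ^+ k :> R by rewrite lerXn2r ?nnegrE; lra.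
have q0 : 0 <= (50 / 51) ^+ k :> R by rewrite exprn_ge0 //; lra.
have [N N2 Nle] : exists2 N : nat, 2 * t <= N%:R * 2 ^+ k &
    N%:R * 2 ^+ k <= 2 * t + 2 ^+ k.
  have tp0 : 0 <= 2 * t / 2 ^+ k by rewrite divr_ge0 ?ltW // mulr_gt0.
  exists (Num.truncn (2 * t / 2 ^+ k)).+1; have /andP[] := truncn_itv tp0.
    by move=> _ /ltW; rewrite ler_pdivrMr.
  by rewrite ler_pdivlMr // => ? _; rewrite -natr1 mulrDl mul1r lerD2r.
apply: (@le_trans _ _
  (lambda (A `&` `[1, 1 + (N * 2 ^ k)%:R * t^-1[))).
  apply: le_measure; rewrite ?inE; try by apply: measurableI.
  apply: setIS; apply: subset_itvl; rewrite bnd_simp.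
  by rewrite natrM natrX -lerBlDl ler_pdivlMr //; lra.
apply: le_trans (measure_cells_le _ _ _ _) _; rewrite ?invr_gt0 //.
(* All cells are translated onto the first one, of length [t^-1]; since
   [t * (x + n / t) = t * x + n], the overlap at [x] is a sum over integer translates. *)
apply: (@le_trans _ _
  ((N%:R * (100 / 51) ^+ k)%:E * lambda `[1%R, (1 + t^-1)%R[)%E).
  apply: (@sum_measure_le _ _ _ lambda _
    (fun n => [set x | A (x + n%:R * t^-1)])) => //.
    move=> n; under eq_set do rewrite -[X in X + _]mul1r.
    exact: measurable_preimage_affine.
  move=> x _; apply: le_trans (sum_often_odd_muln k N (t * x)).
  rewrite le_eqVlt; apply/orP; left; apply/eqP; apply: eq_bigr => n _.
  rewrite !indicE; congr (nat_of_bool _)%:R.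
  apply/idP/idP => /set_mem H; apply/mem_set; move: H;
    rewrite /A /often_odd_dilate /=;
    by rewrite mulrDr mulrCA divff ?mulr1 // gt_eqF.
rewrite lebesgue_measure_itv /= lte_fin ltrDl invr_gt0 t0 -EFinB -EFinM lee_fin.
rewrite addrAC subrr add0r ler_pdivrMr //.
rewrite (_ : 100 / 51 = 2 * (50 / 51) :> R); last by lra.
rewrite exprMn mulrA [leRHS]mulrAC ler_wpM2r //; lra.
Qed.

Definition exceptional_level l : set R :=
  [set y | [/\ 3 ^+ l <= y, y < 3 ^+ l.+1 & often_odd l y]].

Lemma measurable_exceptional_level l : measurable (exceptional_level l).
Proof.
rewrite (_ : exceptional_level l = `[3 ^+ l, 3 ^+ l.+1[ `&` often_odd l).
  by apply: measurableI => //; exact: measurable_often_odd.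
apply/seteqP; split=> x /=; rewrite in_itv /=; first by move=> [-> ->].
by move=> [/andP[]].
Qed.

Definition bad_level l i : set R :=
  [set x | exists m, exceptional_level l (3 ^+ m / 2 ^+ i * x)].

Lemma badE l0 i : bad l0 i = \bigcup_j bad_level (l0 + j) i.
Proof.
apply/seteqP; split=> x.
  move=> [m [l [l0l ? ? ?]]]; exists (l - l0)%N => //; rewrite subnKC //.
  by exists m.
by move=> [j _ [m [? ? ?]]]; exists m, (l0 + j)%N; rewrite leq_addr.
Qed.

Lemma measurable_bad_level l i : measurable (bad_level l i).
Proof.
rewrite (_ : bad_level l i =
  \bigcup_m [set x | exceptional_level l (3 ^+ m / 2 ^+ i * x + 0)]).
  apply: bigcupT_measurable => m.
  exact: measurable_preimage_affine (measurable_exceptional_level _).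
apply/seteqP; split=> x; first by move=> [m H]; exists m; rewrite //= addr0.
by move=> [m _]; rewrite /= addr0; exists m.
Qed.

Lemma measurable_bad l0 i : measurable (bad l0 i : set R).
Proof.
by rewrite badE; apply: bigcupT_measurable => j; exact: measurable_bad_level.
Qed.

(** For [x] in the domain, only two consecutive powers of 3 can bring [x / 2 ^+ i] into the level,
    and each contributes at most [5 * (50 / 51) ^+ l]. *)
Lemma bad_level_measure l i :
  (lambda (bad_level l i `&` domain) <= (10 * (50 / 51) ^+ l)%:E)%E.
Proof.
have large : exists m, 3 ^+ l * 2 ^+ i < 3 ^+ m.+1 :> R.
  have l1 : 1 <= 3 ^+ l * 2 ^+ i :> R by rewrite mulr_ege1 ?exprn_ege1 //; lra.
  have [m [_ lt_m]] := expr_level (ltac:(lra) : 1 < 3 :> R) l1.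
  by exists m.
have [m lt_m min_m] := ex_minnP large.
pose t j : R := 3 ^+ j / 2 ^+ i.
have p0 : 0 < 2 ^+ i :> R by rewrite exprn_gt0.
have t0 j : 0 < t j by rewrite divr_gt0 ?exprn_gt0.
have lt j : (m <= j)%N -> 3 ^+ l <= 3 * t j.
  move=> mj; rewrite /t mulrA -exprS ler_pdivlMr //.
  by rewrite (le_trans (ltW lt_m)) // ler_eXn2l //; lra.
pose D j := often_odd_dilate l (t j) `&` domain.
have mD j : measurable (D j).
  by apply: measurableI => //; exact: measurable_often_odd_dilate.
apply: (@le_trans _ _ (lambda (D m `|` D m.+1))).
  apply: le_measure; rewrite ?inE.
  - by apply: measurableI => //; exact: measurable_bad_level.
  - by apply: measurableU; exact: mD.
  move=> x [[j [jx xj oj]] x13].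
  have /andP[x1 x3] : 1 <= x < 3 by move: x13; rewrite /= in_itv.
  have tj0 := t0 j; rewrite -/(t j) in jx xj oj.
  have mj : (m <= j)%N.
    apply: min_m; rewrite -ltr_pdivlMr // exprS -mulrA -/(t j).
    by apply: le_lt_trans jx _; rewrite mulrC ltr_pM2r.
  have jm : (j < m.+2)%N.
    rewrite -(@ltr_eXn2l R 3); last by lra.
    apply: (@lt_trans _ _ (3 ^+ l.+1 * 2 ^+ i)); last first.
      by rewrite exprS -mulrA exprS ltr_pM2l.
    rewrite -ltr_pdivrMr //; apply: le_lt_trans xj.
    by rewrite ler_peMr // ltW.
  have : (j == m) || (j == m.+1) by lia.
  by move=> /orP[] /eqP jE; [left|right]; rewrite -jE.
apply: (@le_trans _ _ (lambda (D m) + lambda (D m.+1))%E).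
  by apply: measureU2; exact: mD.
rewrite (_ : 10 * _ = 5 * (50 / 51) ^+ l + 5 * (50 / 51) ^+ l); last by lra.
by rewrite EFinD leeD // often_odd_measure // lt.
Qed.

(** Geometric series over the levels: [10 / (1 - 50 / 51) = 510]. The bound is uniform in the time
    [i]. *)
Lemma bad_measure l0 i :
  (lambda (bad l0 i `&` domain) <= (510 * (50 / 51) ^+ l0)%:E)%E.
Proof.
have mB j : measurable (bad_level (l0 + j) i `&` domain).
  by apply: measurableI => //; exact: measurable_bad_level.
apply: (@le_trans _ _
    (\sum_(0 <= j <oo) lambda (bad_level (l0 + j) i `&` domain))%E).
  apply: measure_sigma_subadditive => //.
    by apply: measurableI => //; exact: measurable_bad.
  by rewrite badE setI_bigcupl.
apply: lime_le; first by apply: is_cvg_nneseries.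
apply: nearW => n.
apply: (@le_trans _ _ (\sum_(0 <= j < n) (10 * (50 / 51) ^+ (l0 + j))%:E)%E).
  by apply: lee_sum => j _; exact: bad_level_measure.
rewrite sumEFin lee_fin.
suff -> : \sum_(0 <= j < n) 10 * (50 / 51) ^+ (l0 + j) =
    510 * (50 / 51) ^+ l0 * (1 - (50 / 51) ^+ n) :> R.
  have r0 : 0 <= 50 / 51 :> R by exact: divr_ge0 (ler0n _ _) (ler0n _ _).
  have c0 : 0 <= 510 * (50 / 51) ^+ l0 :> R.
    exact: mulr_ge0 (ler0n _ _) (exprn_ge0 _ r0).
  by apply: ler_piMr; rewrite ?c0 ?gerBl ?exprn_ge0.
elim: n => [|n IH]; first by rewrite big_nil expr0 subrr mulr0.
by rewrite big_nat_recr //= IH exprD exprS; field.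
Qed.

End bad_measure.

(** * Ergodicity of multiplication by 2 modulo multiplication by 3 *)

Section zero_one_law.
Variable R : realType.
Implicit Types (e t x p q r s : R) (a b n : nat).
Local Notation lambda := (@lebesgue_measure R).

Lemma pow2_neq_pow3 a b : (0 < a)%N -> 2 ^+ a != 3 ^+ b :> R.
Proof.
move=> a0; rewrite -!natrX eqr_nat; apply/negP => /eqP /(congr1 odd).
by rewrite !oddX /= orbF orbT; case: a a0.
Qed.

(** Dirichlet's pigeonhole argument: reduce the powers of 2 into [1, 3) by powers of 3; two of them
    fall in the same short box, and their quotient is close to 1. It differs from 1 by parity. *)
Lemma pow2_div_pow3_near1 e : 0 < e ->
  exists a b, [/\ 2 ^+ a / 3 ^+ b != 1 :> R, 1 - e < 2 ^+ a / 3 ^+ b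
    & 2 ^+ a / 3 ^+ b < 1 + e].
Proof.
move=> e0.
have level a : exists b, (3 : R) ^+ b <= 2 ^+ a /\ (2 : R) ^+ a < 3 ^+ b.+1.
  by apply: expr_level; [lra|apply: exprn_ege1; lra].
have [f fP] := choice level.
have p3 a : 0 < 3 ^+ a :> R by rewrite exprn_gt0.
pose v a : R := 2 ^+ a / 3 ^+ f a.
have v1 a : 1 <= v a by rewrite /v ler_pdivlMr // mul1r (fP a).1.
have v3 a : v a < 3 by rewrite /v ltr_pdivrMr // -exprS (fP a).2.
have [N Ne] : exists N : nat, 2 < e * N.+1%:R.
  exists (Num.bound (2 / e)); rewrite mulrC -ltr_pdivrMr //.
  apply: lt_trans (archi_boundP _) _; first by rewrite divr_ge0 // ltW.
  by rewrite ltr_nat.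
(* Index of the box containing [v a], when [1, 3) is cut into [N.+1] boxes of width [2 / N.+1],
   which is less than [e]. *)
pose c a : nat := Num.truncn ((v a - 1) * N.+1%:R / 2).
have c_itv a : (c a)%:R <= (v a - 1) * N.+1%:R / 2 < (c a).+1%:R.
  by apply: truncn_itv; rewrite !mulr_ge0 // subr_ge0.
have cN a : (c a < N.+1)%N.
  rewrite -(ltr_nat R); have /andP[/le_lt_trans -> //] := c_itv a.
  have := v3 a; have : 0 < N.+1%:R :> R by rewrite ltr0n.
  by move: N.+1%:R => M M0 va; rewrite ltr_pdivrMr // mulrC ltr_pM2l //; lra.
have /injectivePn[a [b ab cab]] :
    ~~ injectiveb (fun a : 'I_N.+2 => Ordinal (cN a)).
  apply/injectiveP => /leq_card; rewrite !card_ord; lia.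
have {cab} cab : c a = c b by case: cab.
wlog ltab : a b ab cab / (a < b)%N.
  move=> H; have /orP[|ba] : (a < b)%N || (b < a)%N by rewrite -neq_ltn.
    by apply: H.
  by apply: (H b a); rewrite // eq_sym.
(* Monotonicity of [f] makes [f b - f a] a genuine difference, so that [v b / v a] has the required
   form. *)
have fab : (f a <= f b)%N.
  rewrite -ltnS -(@ltr_eXn2l R 3); last by lra.
  apply: le_lt_trans (fP b).2; apply: le_trans (fP a).1 _.
  by rewrite ler_weXn2l; [|lra|exact: ltnW].
have wE : 2 ^+ (b - a) / 3 ^+ (f b - f a) = v b / v a.
  rewrite /v -[in X in _ = _ ^+ X / _ / _](subnK (ltnW ltab)).
  rewrite -[in X in _ = _ / _ ^+ X / _](subnK fab).
  by rewrite !exprD; field; rewrite !expf_neq0.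
have va1 := v1 a; have va0 : 0 < v a by lra.
have close : - e < v b - v a < e.
  have /andP[a1 a2] := c_itv a; have /andP[b1 b2] := c_itv b.
  rewrite cab in a1 a2; move: a1 a2 b1 b2 Ne.
  have : 0 < N.+1%:R :> R by rewrite ltr0n.
  move: (v a) (v b) (N.+1%:R) => x y M; rewrite -(natr1 (c b)) => M0 ? ? ? ? ?.
  by apply/andP; split; rewrite -(ltr_pM2r M0); lra.
exists (b - a)%N, (f b - f a)%N; split.
  apply/eqP => /(canRL (divfK (lt0r_neq0 (p3 _)))); rewrite mul1r; apply/eqP.
  by rewrite pow2_neq_pow3 // subn_gt0.
- by rewrite wE ltr_pdivlMr //; case/andP: close; nra.
- by rewrite wE ltr_pdivrMr //; case/andP: close; nra.
Qed.

(** Successive powers of a ratio [w] close to 1 cannot jump over the target. If [w > 1], climb from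
    some [1 / 3 ^+ k.+1] below [t]; if [w < 1], descend from some [2 ^+ k.+1] above [t]. Thus 2
    stays in the numerator and 3 in the denominator. *)
Lemma pow2_div_pow3_dense e t : 0 < e < 1 -> 0 < t ->
  exists a b, t * (1 - e) < 2 ^+ a / 3 ^+ b <= t.
Proof.
move=> /andP[e0 e1] t0.
have [a [b [w1 we wd]]] := pow2_div_pow3_near1 e0.
set w := 2 ^+ a / 3 ^+ b in w1 we wd.
have w0 : 0 < w by rewrite divr_gt0 ?exprn_gt0.
have wn n : w ^+ n = 2 ^+ (a * n) / 3 ^+ (b * n) by rewrite expr_div_n !exprM.
have [lt1w|] := ltP 1 w.
  have [k [_ tk]] : exists k,
      3 ^+ k <= Num.max 1 t^-1 /\ Num.max 1 t^-1 < 3 ^+ k.+1.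
    by apply: expr_level; [lra|rewrite le_max lexx].
  have k0 : 0 < 3 ^+ k.+1 :> R by rewrite exprn_gt0.
  have tk1 : 1 <= t * 3 ^+ k.+1.
    rewrite mulrC -ler_pdivrMr // mul1r ltW //.
    by apply: le_lt_trans tk; rewrite le_max lexx orbT.
  have [n [wnt twn]] := expr_level lt1w tk1.
  exists (a * n)%N, (b * n + k.+1)%N.
  rewrite exprD invfM mulrA -wn ltr_pdivlMr // ler_pdivrMr // wnt andbT.
  have we1 : w * (1 - e) <= 1 by nra.
  rewrite mulrAC; apply: (@lt_le_trans _ _ (w ^+ n.+1 * (1 - e))).
    by rewrite ltr_pM2r // subr_gt0.
  by rewrite exprSr -mulrA ler_piMr // exprn_ge0 // ltW.
rewrite le_eqVlt (negbTE w1) /= => ltw1.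
have iw1 : 1 < w^-1 by rewrite invf_gt1.
have [k [_ tk]] : exists k, 2 ^+ k <= Num.max 1 t /\ Num.max 1 t < 2 ^+ k.+1.
  by apply: expr_level; [lra|rewrite le_max lexx].
have tk1 : 1 <= 2 ^+ k.+1 / t.
  rewrite ler_pdivlMr // mul1r ltW //.
  by apply: le_lt_trans tk; rewrite le_max lexx orbT.
have [n []] := expr_level iw1 tk1.
rewrite !exprVn => wnt twn.
exists (k.+1 + a * n.+1)%N, (b * n.+1)%N.
rewrite exprD -mulrA -wn.
have wn0 := exprn_gt0 n w0; have wn10 := exprn_gt0 n.+1 w0.
move: wnt twn; rewrite ler_pdivlMr // mulrC ler_pdivrMr // => wnt.
rewrite ltr_pdivrMr // mulrC ltr_pdivlMr // => twn.
rewrite (ltW twn) andbT.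
apply: (@lt_le_trans _ _ (t * w)); first by rewrite ltr_pM2l.
by rewrite [w ^+ n.+1]exprSr [leRHS]mulrA ler_pM2r.
Qed.

(** Lebesgue's density theorem with density 9/10; a ball of radius [r] has measure [2 * r]. *)
Lemma density_point (A : set R) : measurable A -> lambda A != 0%E ->
  exists x, A x /\ exists2 e : R, 0 < e & forall r, 0 < r < e ->
    ((9 / 5 * r)%:E <= lambda (A `&` ball x r))%E.
Proof.
move=> mA A0.
have [x [Ax xd]] : exists x, A x /\
    (lambda (A `&` ball x r) * (lambda (ball x r))^-1)%E @[r --> 0^'+] --> 1%E.
  apply: contrapT => none; move/eqP : A0; apply.
  apply/negligibleP => //; apply: negligibleS (lebesgue_density mA) => x Ax.
  rewrite /= indicE mem_set // => xd; apply: none.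
  by exists x.
exists x; split => //.
have : \forall r \near 0^'+,
    ((9 / 10)%:E < lambda (A `&` ball x r) * (lambda (ball x r))^-1)%E.
  apply: (xd [set y | ((9 / 10)%:E < y)%E]); apply: open_nbhs_nbhs.
  by split; [exact: open_ereal_gt_ereal|rewrite /= lte_fin; lra].
move=> [e /= e0 He]; exists e => // r /andP[r0 re].
have {He} := He r; rewrite /= sub0r normrN gtr0_norm // => /(_ re r0) H.
have ballE := lebesgue_measure_ball x (ltW r0).
move: H; rewrite ballE inver mulrn_eq0 /= gt_eqF // => H.
have fin : lambda (A `&` ball x r) \is a fin_num.
  rewrite ge0_fin_numE //; apply: (@le_lt_trans _ _ (lambda (ball x r))).
    apply: le_measure; rewrite ?inE //; last exact: measurable_ball.
    by apply: measurableI => //; exact: measurable_ball.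
  by rewrite ballE ltry.
move: H; rewrite -(fineK fin) -EFinM lte_fin lee_fin ltr_pdivlMr ?mulrn_wgt0 //.
by rewrite mulr2n; lra.
Qed.

(** Otherwise take density points [p] of [G] and [q] of [H]. Some [g = 2 ^+ a / 3 ^+ b] moves [p]
    just below [q] and maps [G] into itself, so both sets fill most of one small interval near [q],
    although they are disjoint. *)
Lemma zero_one (G H : set R) : measurable G -> measurable H ->
  G `<=` [set x | 0 < x] -> H `<=` [set x | 0 < x] -> G `&` H = set0 ->
  (forall x, G x -> G (2 * x)) -> (forall x, G x -> G (x / 3)) ->
  lambda G = 0%E \/ lambda H = 0%E.
Proof.
move=> mG mH G_gt0 H_gt0 GH G2 G3.
have [|G0] := eqVneq (lambda G) 0%E; first by left.
have [|H0] := eqVneq (lambda H) 0%E; first by right.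
have Gab a b x : G x -> G (2 ^+ a / 3 ^+ b * x).
  move=> Gx; elim: b => [|b IH].
    rewrite expr0 divr1; elim: a => [|a IH]; first by rewrite expr0 mul1r.
    by rewrite exprS -mulrA; exact: G2.
  move/G3 : IH; congr G; rewrite exprS; field; by rewrite expf_neq0.
have [p [Gp [e1 e10 pd]]] := density_point mG G0.
have [q [Hq [e2 e20 qd]]] := density_point mH H0.
have p0 : 0 < p := G_gt0 _ Gp; have q0 : 0 < q := H_gt0 _ Hq.
have [s s01 [sp sq]] : exists2 s : R, 0 < s < 1 & s * p < e1 /\ s * q < e2.
  exists (Num.min (1 / 2) (Num.min (e1 / p / 2) (e2 / q / 2))).
    by rewrite lt_min !lt_min !divr_gt0 //= gt_min; apply/orP; left; lra.
  split; rewrite -ltr_pdivlMr // !gt_min; apply/orP; right; apply/orP.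
    by left; rewrite ltr_pdivrMr // ltr_pMr ?divr_gt0 //; lra.
  by right; rewrite ltr_pdivrMr // ltr_pMr ?divr_gt0 //; lra.
have /andP[s0 s1] := s01.
have [a [b]] :=
  @pow2_div_pow3_dense (s / 10) (q / p) (ltac:(lra)) (divr_gt0 q0 p0).
have {Gab} := Gab a b; set g := 2 ^+ a / 3 ^+ b => Gg.
have g0 : 0 < g by rewrite divr_gt0 ?exprn_gt0.
rewrite mulrAC ltr_pdivrMr // ler_pdivlMr // => /andP[gp1 gp2].
(* [U] contains the ball around [q] and the dilated ball around [g * p], because [(1 - s / 10) * (1
   - s) >= 1 - 11 / 10 * s]. *)
pose U := `[q * (1 - 11 / 10 * s), q * (1 + s)]%classic.
have mU : measurable U by exact: measurable_itv.
have inU x : (ball q (s * q) x \/ ball p (s * p) (g^-1 * x + 0)) -> U x.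
  rewrite /U /= in_itv /= addr0 => -[|].
    by rewrite ball_itv /= in_itv /= => /andP[? ?]; apply/andP; split; nra.
  rewrite ball_itv /= in_itv /= (mulrC g^-1) ltr_pdivlMr //.
  rewrite ltr_pdivrMr // => /andP[? ?].
  by apply/andP; split; nra.
have HU : ((9 / 5 * (s * q))%:E <= lambda (H `&` U))%E.
  apply: le_trans (qd _ _) _; first by rewrite mulr_gt0.
  apply: le_measure; rewrite ?inE;
    try by apply: measurableI => //; exact: measurable_ball.
  by move=> x [Hx qx]; split => //; apply: inU; left.
have GU : ((9 / 5 * (s * (g * p)))%:E <= lambda (G `&` U))%E.
  have := pd (s * p); rewrite sp mulr_gt0 // => /(_ isT) pG.
  apply: (@le_trans _ _ (g%:E * lambda (G `&` ball p (s * p)))%E).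
    rewrite (_ : 9 / 5 * _ = g * (9 / 5 * (s * p))); last by lra.
    by rewrite EFinM lee_pmul2l.
  have ig0 : 0 < g^-1 by rewrite invr_gt0.
  have := lebesgue_measure_affine 0 ig0
    (measurableI _ _ mG (measurable_ball p (s * p))).
  rewrite invrK => <-; apply: le_measure; rewrite ?inE.
  - apply: (@measurable_preimage_affine _ _ _ (G `&` ball p (s * p))).
    by apply: measurableI => //; exact: measurable_ball.
  - by apply: measurableI => //; exact: measurable_ball.
  move=> x [Gx px]; split; last by apply: inU; right.
  by have := Gg _ Gx; rewrite addr0 mulrA divff ?gt_eqF // mul1r.
have : (lambda (G `&` U) + lambda (H `&` U) <= lambda U)%E.
  rewrite -measureU; try by apply: measurableI.
    apply: le_measure; rewrite ?inE //; last by move=> x [] [].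
    by apply: measurableU; apply: measurableI.
  by rewrite setIACA GH set0I.
move=> /(le_trans (leeD GU HU)) overlap; exfalso; move: overlap.
have sq0 : 0 < s * q by rewrite mulr_gt0.
have gq : 9 / 10 * (s * q) <= s * (g * p).
  rewrite mulrCA ler_pM2l //; apply: le_trans (ltW gp1).
  by rewrite mulrC ler_pM2l //; lra.
(* The two parts have total measure at least [9 / 5 * (1 + 9 / 10) * (s * q)], whereas [U] has
   length only [21 / 10 * (s * q)]. *)
rewrite lebesgue_measure_itv /= lte_fin; case: ifP => _.
  rewrite -EFinB -EFinD lee_fin; clear -sq0 gq; lra.
rewrite -EFinD lee_fin; clear -sq0 gq; lra.
Qed.

End zero_one_law.

(** * Points that are bad too often form a null set *)

Section null_set.
Variable R : realType.
Implicit Types (l n i d : nat).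
Local Notation lambda := (@lebesgue_measure R).
Local Notation domain := (`[1%R, 3%R[%classic : set R).

Lemma measurable_bad_count l0 n :
  measurable_fun [set: R] (fun x : R => bad_count l0 n x).
Proof.
rewrite /bad_count; elim: n => [|n IH].
  by under eq_fun do rewrite big_ord0; exact: measurable_cst.
under eq_fun do rewrite big_ord_recr /=.
apply: measurable_fun_addn => //.
apply: (eq_measurable_fun (fun x : R => if x \in bad l0 n then 1%N else 0%N)).
  by move=> x _; case: (x \in _).
apply: measurable_fun_ifT => //; apply: (measurable_fun_bool true).
rewrite setTI (_ : _ @^-1` _ = bad l0 n); first exact: measurable_bad.
by apply/seteqP; split=> x /=; [exact: set_mem|exact: mem_set].
Qed.

Lemma measurable_bad_often l0 d : measurable (bad_often l0 d : set R).
Proof.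
rewrite (_ : bad_often l0 d = \bigcap_n
  ([set: R] `&` bad_count l0 n @^-1` [set b | n <= 13 * b + d]%N)).
  by apply: bigcapT_measurable => n; exact: measurable_bad_count.
apply/seteqP; split=> x H; first by move=> n _; split=> //; exact: H.
by move=> n; case: (H n Logic.I).
Qed.

(** By [zero_one], either [G] is null or it fills the domain. In the latter case the average
    frequency of bad times would be about 1/13 on a set of measure at least 1, while each time is
    bad with measure at most 1/26. *)
Lemma bad_often_null l0 : 510 * (50 / 51) ^+ l0 <= 1 / 26 :> R ->
  lambda (\bigcup_d bad_often l0 d) = 0%E.
Proof.
move=> small; set G := \bigcup_d bad_often l0 d.
have mG : measurable G.
  by apply: bigcupT_measurable => d; exact: measurable_bad_often.
have mDG : measurable (domain `\` G) by exact: measurableD.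
have domain_null : lambda G = 0%E \/ lambda (domain `\` G) = 0%E.
  apply: zero_one => //.
  - by move=> x [d _ /bad_often_gt0].
  - by move=> x [] /=; rewrite in_itv /= => /andP[? _] _; lra.
  - by apply/seteqP; split=> x // [Gx [_]].
  - by move=> x [d _ xd]; exists d.+1 => //; exact: bad_often_double.
  - by move=> x [d _ xd]; exists d => //; exact: bad_often_third.
have [//|{}domain_null] := domain_null; exfalso.
pose F d : set R := bad_often l0 d `&` domain.
have mF d : measurable (F d).
  by apply: measurableI => //; exact: measurable_bad_often.
have F2 : lambda (\bigcup_d F d) = 2%:E.
  rewrite -setI_bigcupl -/G setIC.
  have : lambda domain = (lambda (domain `\` G) + lambda (domain `&` G))%E.
    exact: measureDI.
  rewrite domain_null add0e => <-.
  by rewrite lebesgue_measure_itv /= lte_fin ifT -?EFinB; [congr EFin|]; lra.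
(* The sets [F d] increase to a set of measure 2, so a single defect [d] serves on measure at least
   1. *)
have [d Fd] : exists d, (1 <= lambda (F d))%E.
  have mUF : measurable (\bigcup_d F d) by exact: bigcupT_measurable.
  have ndF : nondecreasing_seq F.
    move=> a b ab; apply/subsetPset => x [xa ?]; split => // n.
    by apply: leq_trans (xa n) _; rewrite leq_add2l.
  have : lambda (F d) @[d --> \oo] --> lambda (\bigcup_d F d).
    exact: nondecreasing_cvg_mu.
  rewrite F2.
  move=> /(_ [set y | (1%:E < y)%E]) [].
    apply: open_nbhs_nbhs; split; first exact: open_ereal_gt_ereal.
    by rewrite /= lte_fin; lra.
  by move=> d _ /(_ d (leqnn d)) /ltW Fd; exists d.
(* Up to this time there are at least [d.+1 / 13] bad times on [F d], which exceeds [n / 26], the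
   total allowed by the measure bound. *)
pose n := d.*2.+1.
have : ((d.+1%:R / 13)%:E * lambda (F d) <=
    \sum_(i < n) lambda (bad l0 i `&` F d))%E.
  apply: (@sum_measure_ge _ _ _ lambda (F d) (bad l0)) => //.
  - exact: mF.
  - by move=> i; exact: measurable_bad.
  - move=> x [xd _]; under eq_bigr do rewrite indicE.
    rewrite -natr_sum ler_pdivrMr ?ltr0n // -natrM ler_nat.
    by have := xd n; rewrite -/(bad_count l0 n x) /n; lia.
have : (\sum_(i < n) lambda (bad l0 i `&` F d) <=
    \sum_(i < n) (1 / 26)%:E)%E.
  apply: lee_sum => i _.
  apply: (@le_trans _ _ (lambda (bad l0 i `&` domain))).
    apply: le_measure; rewrite ?inE.
    - by apply: measurableI; [exact: measurable_bad|exact: mF].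
    - by apply: measurableI; [exact: measurable_bad|exact: measurable_itv].
    - by move=> x [? []].
  apply: (@le_trans _ _ (510 * (50 / 51) ^+ l0)%:E); first exact: bad_measure.
  by rewrite lee_fin.
move=> /[swap] /le_trans /[apply].
have : ((d.+1%:R / 13)%:E * 1 <= (d.+1%:R / 13)%:E * lambda (F d))%E.
  by rewrite lee_pmul2l // lte_fin divr_gt0 ?ltr0n.
move=> /le_trans /[apply].
rewrite mule1 sumEFin lee_fin sumr_const card_ord -[leRHS]mulr_natl /n.
rewrite -addnn -(natr1 d) -(natr1 (d + d)) natrD.
by clear; move: (d%:R) => x; lra.
Qed.

Lemma small_bad_level :
  exists2 l0, (0 < l0)%N & 510 * (50 / 51) ^+ l0 <= 1 / 26 :> R.
Proof.
have b1 : 1 < 51 / 50 :> R by lra.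
have x1 : 1 <= 510 * 26 :> R by rewrite mulr_ege1 ?ler1n.
have [l [_ lx]] := expr_level b1 x1; exists l.+1 => //.
have : 0 < (50 / 51) ^+ l.+1 :> R.
  exact: exprn_gt0 (divr_gt0 (ltr0Sn _ _) (ltr0Sn _ _)).
have : (51 / 50) ^+ l.+1 * (50 / 51) ^+ l.+1 = 1 :> R.
  by rewrite -exprMn (_ : 51 / 50 * (50 / 51) = 1) ?expr1n //; lra.
move: lx; move: ((51 / 50) ^+ l.+1) ((50 / 51) ^+ l.+1) => u v; nra.
Qed.

End null_set.

(** * From lower limits of orbits to the exceptional null set *)

Lemma limn_einf_gt (R : realType) (u : nat -> R) (K : R) :
  (K%:E < limn_einf (fun n => (u n)%:E))%E ->
  exists n, forall k, K <= u (k + n)%N.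
Proof.
rewrite limn_einf_lim (cvg_lim _ (@cvg_einfs_sup _ _)) //.
move=> /ereal_sup_gt[_ [n _ <-]] Kn; exists n => k.
rewrite -lee_fin; apply: (le_trans (ltW Kn)).
by apply: ereal_inf_lbound; exists (k + n)%N => //=; rewrite leq_addl.
Qed.

Theorem theorem1p2 (R : realType) :
  exists K : R, 0 < K /\
    lebesgue_conull
      [set x : R | 3 / 4 < x /\
        (limn_einf (fun n : nat => (iter n (@collatz_real R) x)%:E) <= K%:E)%E]
      [set x : R | 3 / 4 < x].
Proof.
have [l0 l0_gt0 small] := small_bad_level R.
exists (3 ^+ l0); split; first by rewrite exprn_gt0.
set A := [set x | _ /\ _]; set B := [set x | _].
pose G : set R := \bigcup_d bad_often l0 d.
have mG : measurable G.
  by apply: bigcupT_measurable => d; exact: measurable_bad_often.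
have G0 : completed_lebesgue_measure G = 0%E by exact: bad_often_null.
(* A lower limit above [3 ^+ l0] keeps the orbit above that level from some time [n] on; the iterate
   at time [n] is then bad often, and this is pulled back to [x]. *)
have BAG : B `\` A `<=` G.
  move=> x [Bx nA].
  have [|n orb] :=
    @limn_einf_gt _ (fun n => iter n (@collatz_real R) x) (3 ^+ l0).
    by rewrite ltNge; apply/negP => H; apply: nA; split.
  have [|d xd] := @bad_often_iter _ l0 n x; last by exists d.
  by apply: orbit_bad_often => // k; rewrite -iterD.
have mB : lebesgue_measurable B.
  apply: sub_caratheodory; rewrite (_ : B = `]3 / 4, +oo[%classic).
    exact: measurable_itv.
  by apply/seteqP; split=> x; rewrite /B /= in_itv /= andbT.
have AB : A `<=` B by move=> x [].
(* Measurability of [A] comes from completeness: [B] minus [A] lies in a null set, hence is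
   measurable, and [A] is its complement in [B]. *)
have neg : (@completed_lebesgue_measure R).-negligible (B `\` A).
  by exists G; split => //; exact: sub_caratheodory.
have mBA : lebesgue_measurable (B `\` A) by exact: negligible_sub_caratheodory.
split => //.
  by rewrite -(setIidr AB) -setDD; exact: measurableD.
by apply/negligibleP.
Qed.
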